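(* Let $p_0\in(0,1)$, $a,b>0$, $\pi\in(0,1)$, and let $G=\pi\,\mathrm{Beta}(a,b)+(1-\pi)\,\delta_1$ (a mixture with an atom of mass $1-\pi$ at $\alpha=1$). For integers $k\ge0$ let $m_k=\mathbb{E}_{\alpha\sim G}[\alpha^k]$, $r_k=\frac{p_0}{p_0+(1-p_0)m_k}$ and $\ell_k=\ln\frac{p_0}{1-p_0}-\ln m_k$. Then $m_k$ decreases to $1-\pi$ as $k\to\infty$, and $$\sup_{k}\,(\ell_k-\ell_0)=-\ln(1-\pi),\qquad r_\infty:=\lim_{k\to\infty}r_k=\frac{p_0}{p_0+(1-p_0)(1-\pi)}<1.$$
   Context: Interpretation: $r_k$ (with log-odds $\ell_k=\ln\frac{r_k}{1-r_k}$) is the probability that a candidate answer is correct given that $k$ verification gates all accepted it, where $p_0$ is the prior probability of correctness, correct answers are always accepted, and erroneous answers have a latent false-accept rate $\alpha\sim G$ given which gate verdicts are i.i.d. Bernoulli$(\alpha)$. *)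

(* Defs.v *)
From HB Require Import structures.
From mathcomp Require Import all_boot all_order all_algebra.
From mathcomp Require Import all_classical all_reals all_analysis.
From mathcomp Require Import measurable_realfun.
From mathcomp Require Import ring lra.

Set Implicit Arguments.
Unset Strict Implicit.
Unset Printing Implicit Defensive.

Import Order.TTheory GRing.Theory Num.Theory.
Import numFieldNormedType.Exports.

Local Open Scope classical_set_scope.
Local Open Scope ring_scope.

(* The library's [beta_prob] only has natural-number parameters; this section
   builds Beta(a, b) for arbitrary real a, b > 0. *)
Section real_beta.
Context {R : realType}.
Local Notation mu := (@lebesgue_measure R).
Implicit Types a b x : R.

Definition rbeta_kernel a b : R -> R :=
  (fun x => x `^ (a - 1) * (1 - x) `^ (b - 1)) \_ `]0, 1[.

Definition rbeta_fun a b : R := \int[mu]_x rbeta_kernel a b x.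

Definition rbeta_pdf a b x : R := rbeta_kernel a b x / rbeta_fun a b.

Lemma rbeta_kernel_ge0 a b x : 0 <= rbeta_kernel a b x.
Proof. by apply: restrict_ge0 => y _; rewrite mulr_ge0 ?powR_ge0. Qed.

Lemma rbeta_kernel_gt0 a b x : 0 < x < 1 -> 0 < rbeta_kernel a b x.
Proof.
move=> /andP[x0 x1]; rewrite /rbeta_kernel patchE mem_set/=; last first.
  by rewrite in_itv/= x0 x1.
by rewrite mulr_gt0 ?powR_gt0 ?subr_gt0.
Qed.

Lemma measurable_rbeta_kernel a b : measurable_fun setT (rbeta_kernel a b).
Proof.
apply/measurable_restrict => //; apply: measurable_funTS.
apply: measurable_funM; first exact: measurable_powR.
apply: (@measurableT_comp _ _ _ _ _ _ (@powR R ^~ (b - 1))) => //.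
exact: measurable_funB.
Qed.

Lemma powR_half_bound c x : 2^-1 <= x <= 1 ->
  x `^ c <= 1 + 2^-1 `^ c.
Proof.
move=> /andP[x2 x1]; have x0 : 0 < x by apply: lt_le_trans x2; lra.
have [c0|c0] := leP 0 c.
  rewrite (@le_trans _ _ (1 `^ c))//.
    by apply: ge0_ler_powR => //; rewrite nnegrE; lra.
  by rewrite powR1 lerDl powR_ge0.
rewrite (@le_trans _ _ (2^-1 `^ c))//; last by rewrite lerDr.
rewrite -(opprK c) 2!(powRN _ (- c)) lef_pV2 ?posrE ?powR_gt0//.
by apply: ge0_ler_powR; rewrite ?nnegrE//; lra.
Qed.

Let dom a b x : R := x `^ (a - 1) + (1 - x) `^ (b - 1).
Let primdom a b x : R := x `^ a / a - (1 - x) `^ b / b.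

Let is_derive_primdom a b x : 0 < a -> 0 < b -> 0 < x < 1 ->
  is_derive x (1 : R) (primdom a b) (dom a b x).
Proof.
move=> a0 b0 /andP[x0 x1]; have x1' : 0 < 1 - x by lra.
have d1 := is_derive1_powR a x0.
have d2 := is_derive1_powR b x1'.
have d3 : is_derive x (1 : R) (fun y : R => 1 - y) (-1).
  by apply: is_derive_eq; rewrite add0r mul1r.
have d4 := @is_derive1_comp R (fun y : R => y `^ b) (fun y : R => 1 - y)
  x _ _ d2 d3.
have -> : primdom a b = a^-1 *: (fun y : R => y `^ a) -
    b^-1 *: ((fun y : R => y `^ b) \o (fun y : R => 1 - y)).
  by apply/funext => y; rewrite /primdom !fctE /GRing.scale/=; ring.
apply: is_derive_eq.
by rewrite /dom /GRing.scale/=; field; rewrite !gt_eqF.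
Qed.

Let continuous_dom a b x : 0 < x < 1 -> {for x, continuous (dom a b)}.
Proof.
move=> /andP[x0 x1]; have x1' : 0 < 1 - x by lra.
have d1 := is_derive1_powR (a - 1) x0.
have d2 := is_derive1_powR (b - 1) x1'.
have d3 : is_derive x (1 : R) (fun y : R => 1 - y) (-1).
  by apply: is_derive_eq; rewrite add0r mul1r.
have d4 := @is_derive1_comp R (fun y : R => y `^ (b - 1)) (fun y : R => 1 - y)
  x _ _ d2 d3.
apply: differentiable_continuous; apply/derivable1_diffP.
by rewrite (_ : dom a b = (fun y : R => y `^ (a - 1)) +
    ((fun y : R => y `^ (b - 1)) \o (fun y : R => 1 - y)))//.
Qed.

Let dom_ge0 a b x : 0 <= dom a b x.
Proof. by rewrite addr_ge0 ?powR_ge0. Qed.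

Let integral_dom_le a b (e : R) : 0 < a -> 0 < b -> 0 < e < 2^-1 ->
  (\int[mu]_(x in `[e, (1 - e)%R]) (dom a b x)%:E <= (a^-1 + b^-1)%:E)%E.
Proof.
move=> a0 b0 /andP[e0 e2].
have in01 x : e <= x <= 1 - e -> 0 < x < 1.
  by move=> /andP[? ?]; apply/andP; split; lra.
rewrite (@continuous_FTC2 _ _ (primdom a b)).
- rewrite -EFinB lee_fin /primdom.
  have p1 c (c0 : 0 < c) x : 0 <= x <= 1 -> 0 <= x `^ c / c <= c^-1.
    move=> /andP[x0 x1]; apply/andP; split.
      by apply: divr_ge0; [exact: powR_ge0|exact: ltW].
    rewrite ler_pdivrMr// mulVf ?gt_eqF//.
    apply: (@le_trans _ _ (1 `^ c)); last by rewrite powR1.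
    by apply: ge0_ler_powR => //; [exact: ltW|rewrite nnegrE].
  have := p1 a a0 e; have := p1 a a0 (1 - e); have := p1 b b0 e.
  have := p1 b b0 (1 - e).
  rewrite (_ : 1 - (1 - e) = e); last by ring.
  have -> : 0 <= e <= 1 by apply/andP; split; lra.
  have -> : 0 <= 1 - e <= 1 by apply/andP; split; lra.
  move=> /(_ isT)/andP[? ?] /(_ isT)/andP[? ?] /(_ isT)/andP[? ?].
  by move=> /(_ isT)/andP[? ?]; lra.
- by lra.
- apply: continuous_in_subspaceT => x; rewrite inE/= in_itv/= => /in01.
  exact: continuous_dom.
- have cp x : 0 < x < 1 -> primdom a b y @[y --> x] --> primdom a b x.
    move=> x01; apply: differentiable_continuous; apply/derivable1_diffP.
    exact: (@ex_derive _ _ _ _ _ _ _ (is_derive_primdom a0 b0 x01)).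
  split.
  + move=> x; rewrite in_itv/= => /andP[? ?].
    have x01 : 0 < x < 1 by apply/andP; split; lra.
    exact: (@ex_derive _ _ _ _ _ _ _ (is_derive_primdom a0 b0 x01)).
  + by apply: cvg_at_right_filter; apply: cp; apply/andP; split; lra.
  + by apply: cvg_at_left_filter; apply: cp; apply/andP; split; lra.
- move=> x; rewrite in_itv/= => /andP[? ?].
  have x01 : 0 < x < 1 by apply/andP; split; lra.
  rewrite derive1E.
  exact: (@derive_val _ _ _ _ _ _ _ (is_derive_primdom a0 b0 x01)).
Qed.

Let kernel_le_dom a b x : rbeta_kernel a b x <=
  (2 + 2^-1 `^ (a - 1) + 2^-1 `^ (b - 1)) * (dom a b \_ `]0, 1[) x.
Proof.
rewrite /rbeta_kernel !patchE; case: ifPn => [|_]; last by rewrite mulr0.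
rewrite inE/= in_itv/= => /andP[x0 x1].
have ha := powR_ge0 (2^-1 : R) (a - 1).
have hb := powR_ge0 (2^-1 : R) (b - 1).
have hxa := powR_ge0 x (a - 1).
have hxb := powR_ge0 (1 - x) (b - 1).
rewrite /dom; have [x2|x2] := leP x 2^-1.
  have /(powR_half_bound (b - 1)) h : 2^-1 <= 1 - x <= 1.
    by apply/andP; split; lra.
  by rewrite mulrDr; nra.
have /(powR_half_bound (a - 1)) h : 2^-1 <= x <= 1.
  by apply/andP; split; lra.
by rewrite mulrDr; nra.
Qed.

Let measurable_dom a b : measurable_fun setT (dom a b).
Proof.
apply: measurable_funD; first exact: measurable_powR.
apply: (@measurableT_comp _ _ _ _ _ _ (@powR R ^~ (b - 1))) => //.
exact: measurable_funB.
Qed.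

Let cover_oo : `]0, 1[%classic =
  \bigcup_n `[(n.+3%:R^-1 : R), (1 - n.+3%:R^-1)%R]%classic.
Proof.
apply/seteqP; split => [x|x [n _]]/=; rewrite !in_itv/= => /andP[].
  move=> x0 x1.
  pose y := Num.min x (1 - x).
  have y0 : 0 < y by rewrite lt_min x0 subr_gt0.
  exists (Num.truncn y^-1) => //=.
  have h : (Num.truncn y^-1).+3%:R^-1 <= y.
    rewrite -[leRHS]invrK lef_pV2 ?posrE ?invr_gt0 ?ltr0n//.
    have := truncnS_gt y^-1; move/ltW => /le_trans; apply.
    by rewrite ler_nat; apply: leqW; apply: leqW.
  have hx : y <= x by rewrite ge_min lexx.
  have hy : y <= 1 - x by rewrite ge_min lexx orbT.
  rewrite in_itv/=; move: (_^-1) h => e h.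
  by apply/andP; split; lra.
have : 0 < n.+3%:R^-1 :> R by rewrite invr_gt0.
by move: (_^-1) => e *; apply/andP; split; lra.
Qed.

Let integral_dom_lty a b : 0 < a -> 0 < b ->
  (\int[mu]_(x in `]0%R, 1%R[) (dom a b x)%:E < +oo)%E.
Proof.
move=> a0 b0; rewrite cover_oo.
pose F n := `[(n.+3%:R^-1 : R), (1 - n.+3%:R^-1)%R]%classic.
have ndF : nondecreasing_seq F.
  move=> m n mn; rewrite subsetEset => x; rewrite /F/= !in_itv/= => /andP[h1 h2].
  have : n.+3%:R^-1 <= m.+3%:R^-1 :> R.
    by rewrite lef_pV2 ?posrE ?ltr0n// ler_nat !ltnS.
  move: (n.+3%:R^-1) (m.+3%:R^-1) h1 h2 => e1 e2 *.
  by apply/andP; split; lra.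
have mF i : measurable (F i) by exact: measurable_itv.
have cF : (\int[mu]_(x in F n) (dom a b x)%:E @[n --> \oo] -->
    \int[mu]_(x in \bigcup_n F n) (dom a b x)%:E)%E.
  apply: ge0_nondecreasing_set_cvg_integral => //.
    by move=> n; apply/measurable_EFinP; apply: measurable_funTS; exact: measurable_dom.
  by move=> n x _; rewrite lee_fin dom_ge0.
apply: le_lt_trans (ltry (a^-1 + b^-1)%R).
have cvgF := cvgP _ cF.
rewrite -/(F) -(cvg_lim _ cF)//.
apply: lime_le => //.
apply: nearW => n; apply: integral_dom_le => //.
by rewrite invr_gt0 ltr0n/= ltf_pV2 ?posrE ?ltr0n// ltr_nat.
Qed.

Lemma integrable_rbeta_kernel a b : 0 < a -> 0 < b ->
  mu.-integrable setT (EFin \o rbeta_kernel a b).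
Proof.
move=> a0 b0; set C := 2 + 2^-1 `^ (a - 1) + 2^-1 `^ (b - 1).
have C0 : 0 <= C by rewrite !addr_ge0 ?powR_ge0.
have mrd : measurable_fun setT (dom a b \_ `]0, 1[).
  by apply/measurable_restrict => //; apply: measurable_funTS;
    exact: measurable_dom.
pose g (x : measurableTypeR R) :=
  (C%:E * (EFin \o (dom a b \_ `]0%R, 1%R[)) x)%E.
apply: (@le_integrable _ (measurableTypeR R) R mu setT measurableT _ g).
- by apply/measurable_EFinP; exact: measurable_rbeta_kernel.
- move=> x _ /=; rewrite lee_fin ger0_norm ?rbeta_kernel_ge0//.
  by rewrite (le_trans (kernel_le_dom a b x))// ler_norm.
apply: integrableZl => //; apply/integrableP; split.
  exact/measurable_EFinP.
under eq_integral => x _.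
  rewrite gee0_abs; last by rewrite lee_fin restrict_ge0.
  over.
have := integral_dom_lty a0 b0.
by rewrite [X in (X < _)%E -> _]integral_mkcond restrict_EFin.
Qed.

Lemma EFin_rbeta_fun a b : 0 < a -> 0 < b ->
  ((rbeta_fun a b)%:E = \int[mu]_x (rbeta_kernel a b x)%:E)%E.
Proof.
move=> a0 b0; rewrite /rbeta_fun /Rintegral fineK//.
by apply: integrable_fin_num => //; exact: integrable_rbeta_kernel.
Qed.

Lemma rbeta_fun_ge0 a b : 0 <= rbeta_fun a b.
Proof. by apply: Rintegral_ge0 => x _; exact: rbeta_kernel_ge0. Qed.

Lemma rbeta_fun_gt0 a b : 0 < a -> 0 < b -> 0 < rbeta_fun a b.
Proof.
move=> a0 b0; rewrite lt_neqAle rbeta_fun_ge0 andbT; apply/eqP => B0.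
have mk : measurable_fun setT (EFin \o rbeta_kernel a b).
  by apply/measurable_EFinP; exact: measurable_rbeta_kernel.
have : (\int[mu]_x `|(EFin \o rbeta_kernel a b) x| = 0)%E.
  under eq_integral => x _.
    rewrite gee0_abs; last by rewrite lee_fin rbeta_kernel_ge0.
    over.
  by rewrite /= -EFin_rbeta_fun// -B0.
move/(ae_eq_integral_abs mu measurableT mk) => [N [mN N0 kN]].
have sub : `]0, 1[%classic `<=` N.
  move=> x /=; rewrite in_itv/= => x01; apply: kN => /= /(_ I)[].
  by apply/eqP; rewrite gt_eqF// rbeta_kernel_gt0.
have : (mu `]0%R, 1%R[%classic <= mu N)%E by rewrite le_measure ?inE.
by rewrite N0 lebesgue_measure_itv/= lte_fin ltr01 oppr0 adde0 lee_fin ler10.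
Qed.

Lemma rbeta_pdf_ge0 a b x : 0 <= rbeta_pdf a b x.
Proof. by rewrite divr_ge0 ?rbeta_kernel_ge0 ?rbeta_fun_ge0. Qed.

Lemma measurable_rbeta_pdf a b : measurable_fun setT (rbeta_pdf a b).
Proof. by apply: measurable_funM => //; exact: measurable_rbeta_kernel. Qed.

Definition rbeta_prob a b (a0 : 0 < a) (b0 : 0 < b) : set R -> \bar R :=
  fun U => (\int[mu]_(x in U) (rbeta_pdf a b x)%:E)%E.

Section instances.
Variables (a b : R) (a0 : 0 < a) (b0 : 0 < b).

Let rbeta0 : rbeta_prob a0 b0 set0 = 0%E.
Proof. by rewrite /rbeta_prob integral_set0. Qed.

Let rbeta_ge0 U : (0 <= rbeta_prob a0 b0 U)%E.
Proof. by apply: integral_ge0 => x _; rewrite lee_fin rbeta_pdf_ge0. Qed.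

Let rbeta_sigma_additive : semi_sigma_additive (rbeta_prob a0 b0).
Proof.
move=> /= F mF tF mUF; rewrite /rbeta_prob; apply: cvg_toP.
  apply: ereal_nondecreasing_is_cvgn => m n mn.
  apply: lee_sum_nneg_natr => // k _ _; apply: integral_ge0 => /= x Fkx.
  by rewrite lee_fin rbeta_pdf_ge0.
rewrite ge0_integral_bigcup//=.
- apply/measurable_funTS/measurableT_comp => //.
  exact: measurable_rbeta_pdf.
- by move=> x _; rewrite lee_fin rbeta_pdf_ge0.
Qed.

HB.instance Definition _ := isMeasure.Build _ _ _ (rbeta_prob a0 b0)
  rbeta0 rbeta_ge0 rbeta_sigma_additive.

Let rbeta_setT : rbeta_prob a0 b0 [set: R] = 1%E.
Proof.
rewrite /rbeta_prob /rbeta_pdf; under eq_integral do rewrite EFinM.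
rewrite ge0_integralZr//=.
- by rewrite -EFin_rbeta_fun// -EFinM divff// gt_eqF// rbeta_fun_gt0.
- by apply/measurable_EFinP; exact: measurable_rbeta_kernel.
- by move=> x _; rewrite lee_fin rbeta_kernel_ge0.
- by rewrite lee_fin invr_ge0 rbeta_fun_ge0.
Qed.

HB.instance Definition _ := @Measure_isProbability.Build _ _ R
  (rbeta_prob a0 b0) rbeta_setT.

End instances.

End real_beta.

Definition mixture_prob {d : measure_display} {T : measurableType d}
    {R : realType} (p : R) (p01 : 0 < p < 1) (P Q : probability T R) :
    set T -> \bar R :=
  fun U => (p%:E * P U + (1 - p)%:E * Q U)%E.

Section mixture_instances.
Context {d : measure_display} {T : measurableType d} {R : realType}.
Variables (p : R) (p01 : 0 < p < 1) (P Q : probability T R).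

Let p_ge0 : 0 <= p. Proof. by case/andP: p01 => /ltW. Qed.

Let onemp_ge0 : 0 <= 1 - p.
Proof. by case/andP: p01 => _ /ltW; rewrite subr_ge0. Qed.

Let mixtureE : mixture_prob p01 P Q =
  measure_add (mscale (NngNum p_ge0) P) (mscale (NngNum onemp_ge0) Q).
Proof. by apply/funext => U; rewrite measure_addE. Qed.

Let mixture0 : mixture_prob p01 P Q set0 = 0%E.
Proof. by rewrite /mixture_prob !measure0 !mule0 adde0. Qed.

Let mixture_ge0 U : (0 <= mixture_prob p01 P Q U)%E.
Proof. by rewrite adde_ge0// mule_ge0// lee_fin. Qed.

Let mixture_sigma_additive : semi_sigma_additive (mixture_prob p01 P Q).
Proof. by rewrite mixtureE; exact: measure_semi_sigma_additive. Qed.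

HB.instance Definition _ := isMeasure.Build _ _ _ (mixture_prob p01 P Q)
  mixture0 mixture_ge0 mixture_sigma_additive.

Let mixture_setT : mixture_prob p01 P Q [set: T] = 1%E.
Proof.
by rewrite /mixture_prob !probability_setT !mule1 -EFinD addrC subrK.
Qed.

HB.instance Definition _ := @Measure_isProbability.Build _ _ R
  (mixture_prob p01 P Q) mixture_setT.

End mixture_instances.

(* The expectation is finite as soon as G is carried by [0, 1], so [fine] is
   then a mere cast to R. *)
Definition gate_moment {R : realType} (G : probability R R) (k : nat) : R :=
  fine 'E_G[fun alpha => alpha ^+ k].

(* Main.v *)
(* For G carried by [0, 1], m_k - m_(k+1) is the integral of x^k (1 - x), which
   is positive as soon as G charges ]0, 1[, and m_k tends to G {1} by dominated
   convergence. Beta(a, b) is carried by ]0, 1[, so for the mixture only the atom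
   survives in the limit. Since m_0 = 1, l_k - l_0 = - ln m_k is nondecreasing
   and its supremum is its limit. *)
Require Import Defs.
From HB Require Import structures.
From mathcomp Require Import all_boot all_order all_algebra.
From mathcomp Require Import all_classical all_reals all_analysis.
From mathcomp Require Import measurable_realfun.
From mathcomp Require Import lra.

Set Implicit Arguments.
Unset Strict Implicit.
Unset Printing Implicit Defensive.

Import Order.TTheory GRing.Theory Num.Theory.
Import numFieldNormedType.Exports.

Local Open Scope classical_set_scope.
Local Open Scope ring_scope.

Section moments.
Context {R : realType} (G : probability R R).
Hypothesis G01 : G (~` `[0, 1]) = 0%E.

Let m01 : measurable (`[0, 1] : set R). Proof. exact: measurable_itv. Qed.

(** By [G01] the power and its restriction to [[0, 1]] agree almost everywhere. On [[0, 1]] powers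
    lie between 0 and 1, so finiteness, linearity and domination become immediate. *)
Lemma gate_momentE k :
  gate_moment G k = \int[G]_(x in `[0, 1]) (x ^+ k).
Proof.
rewrite /gate_moment unlock /Rintegral; congr fine.
rewrite [RHS]integral_mkcond; apply: ae_eq_integral => //.
- by apply/measurable_EFinP; exact: exprn_measurable.
- apply/(measurable_restrictT _ m01)/measurable_funTS/measurable_EFinP.
  exact: exprn_measurable.
exists (~` `[0, 1]); split => //; first exact: measurableC.
move=> x /= Hx x01; apply: Hx => _.
by rewrite patchE mem_set.
Qed.

Lemma integrable_exprn k : G.-integrable `[0, 1] (fun x => (x ^+ k)%:E).
Proof.
apply: (le_integrable m01 (g := cst 1%E)).
- by apply/measurable_EFinP; apply: measurable_funTS; exact: exprn_measurable.
- move=> x /=; rewrite in_itv/= => /andP[x0 x1].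
  by rewrite lee_fin !ger0_norm ?exprn_ge0 ?exprn_ile1.
- exact: (finite_measure_integrable_cst G 1).
Qed.

Lemma gate_moment0 : gate_moment G 0 = 1.
Proof.
rewrite /gate_moment unlock; under eq_integral do rewrite expr0.
by rewrite integral_cst ?mul1e ?[X in fine X]probability_setT.
Qed.

Lemma gate_moment_decreasing :
  (0 < G `]0%R, 1%R[%classic)%E -> decreasing_seq (gate_moment G).
Proof.
move=> Goo; apply/decreasing_seqP => k.
rewrite -subr_gt0 !gate_momentE -RintegralB//; try exact: integrable_exprn.
pose f (x : R) := x ^+ k - x ^+ k.+1.
have fE x : f x = x ^+ k * (1 - x) by rewrite /f exprSr mulrBr mulr1.
have f0 x : `[0, 1]%classic x -> 0 <= f x.
  rewrite /= in_itv/= fE => /andP[x0 x1].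
  by rewrite mulr_ge0 ?exprn_ge0 ?subr_ge0.
have mf : measurable_fun (`[0, 1] : set R) (EFin \o f).
  apply/measurable_EFinP; apply: measurable_funTS.
  by apply: measurable_funB; exact: exprn_measurable.
(* Finiteness lets a null real integral be read back as a null extended one, despite the cast
   [fine]. *)
have ifin : (\int[G]_(x in `[0%R, 1%R]) (f x)%:E)%E \is a fin_num.
  apply: integrable_fin_num => //.
  have := integrableB m01 (integrable_exprn k) (integrable_exprn k.+1).
  by apply: eq_integrable.
rewrite lt_neqAle Rintegral_ge0 ?andbT//.
apply/eqP => I0.
have : (\int[G]_(x in `[0%R, 1%R]) `|(EFin \o f) x| = 0)%E.
  under eq_integral => x /set_mem x01.
    rewrite gee0_abs; last by rewrite lee_fin f0.
    over.
  by rewrite /= -(fineK ifin); congr EFin.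
(* A nonnegative function with null integral vanishes outside a null set [N]; since [f] is positive
   on []0, 1[], that interval lies in [N], against [Goo]. *)
move/(ae_eq_integral_abs G m01 mf) => [N [mN N0 kN]].
have sub : `]0, 1[%classic `<=` N.
  move=> x /=; rewrite in_itv/= => /andP[x0 x1]; apply: kN => /=.
  rewrite in_itv/= (ltW x0) (ltW x1) => /(_ isT)[].
  by apply/eqP; rewrite fE gt_eqF// mulr_gt0 ?exprn_gt0 ?subr_gt0.
have : (G `]0%R, 1%R[%classic <= G N)%E by rewrite le_measure ?inE.
by rewrite N0 leNgt Goo.
Qed.

Lemma gate_moment_cvg : gate_moment G @ \oo --> fine (G [set 1]).
Proof.
have mi : measurable_fun (`[0, 1] : set R) (fun x => (\1_[set 1] x : R)%:E).
  by apply/measurable_EFinP; exact: measurable_indic.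
(* On [[0, 1]] the powers tend pointwise to the indicator of 1 and are dominated by 1. Of the three
   conclusions only the convergence of the integrals is kept. *)
have [k||||_ _] := @dominated_convergence _ _ _ G _ m01
  (fun k x => (x ^+ k)%:E) (fun x => (\1_[set 1] x)%:E) (cst 1%E) _ mi.
- apply/measurable_EFinP; apply: measurable_funTS.
  exact: exprn_measurable.
- apply: aeW => x /=; rewrite in_itv/= => /andP[x0 x1].
  apply: cvg_EFin; first exact: nearW.
  rewrite indicE in_set1; have [->|xn1] := eqVneq x 1.
    by apply: cvg_near_cst; apply: nearW => k /=; rewrite expr1n.
  by apply: cvg_expr; rewrite ger0_norm// lt_neqAle xn1.
- exact: (finite_measure_integrable_cst G 1).
- apply: aeW => x k /=; rewrite in_itv/= => /andP[x0 x1].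
  by rewrite lee_fin ger0_norm ?exprn_ge0 ?exprn_ile1.
rewrite integral_indic// setIidl; last first.
  by move=> x -> /=; rewrite in_itv/= ler01 lexx.
rewrite -[X in _ --> X]fineK ?fin_num_measure// => /fine_cvg.
by rewrite (funext gate_momentE).
Qed.

End moments.

Section mixture.
Context {R : realType} (a b p : R).
Hypotheses (a0 : 0 < a) (b0 : 0 < b) (p01 : 0 < p < 1).

(** The kernel is patched by 0 outside []0, 1[], so the density vanishes there. *)
Lemma rbeta_prob_setC_oo : rbeta_prob a0 b0 (~` `]0, 1[) = 0%E.
Proof.
apply: integral0_eq => x /= /negP x01; rewrite /rbeta_pdf /rbeta_kernel patchE.
by rewrite memNset ?mul0r//; apply/negP.
Qed.

Lemma rbeta_prob_oo : rbeta_prob a0 b0 `]0, 1[ = 1%E.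
Proof.
rewrite -[`]0, 1[%classic]setCK probability_setC; last exact: measurableC.
by rewrite [X in (1 - X)%E]rbeta_prob_setC_oo sube0.
Qed.

Lemma rbeta_prob_disjoint_oo (A : set R) : measurable A ->
  A `<=` ~` `]0, 1[ -> rbeta_prob a0 b0 A = 0%E.
Proof.
move=> mA /(subset_measure0 (mu := rbeta_prob a0 b0)); apply => //.
  exact: measurableC.
exact: rbeta_prob_setC_oo.
Qed.

Let G := mixture_prob p01 (rbeta_prob a0 b0) \d_(1 : R).

(** Both components are carried by [[0, 1]]; this provides the hypothesis [G01] of the moment
    lemmas. *)
Lemma mixture_setC_cc : G (~` `[0, 1]) = 0%E.
Proof.
rewrite /G /mixture_prob [X in (_ * X + _)%E]rbeta_prob_disjoint_oo.
- rewrite mule0 add0e [X in (_ * X)%E]diracE memNset ?mule0//=; apply.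
  by rewrite in_itv/= ler01 lexx.
- exact: measurableC.
- by apply: subsetC; exact: subset_itv_oo_cc.
Qed.

Lemma mixture_set1 : G [set 1] = (1 - p)%:E.
Proof.
rewrite /G /mixture_prob [X in (_ * X + _)%E]rbeta_prob_disjoint_oo//.
  by rewrite mule0 add0e [X in (_ * X)%E]diracE mem_set// mule1.
by move=> x -> /=; rewrite in_itv/= ltxx andbF.
Qed.

(** The atom at 1 misses the open interval; as [p] is positive, this yields the strict decrease of
    the moments. *)
Lemma mixture_oo : G `]0, 1[ = p%:E.
Proof.
rewrite /G /mixture_prob [X in (_ * X + _)%E]rbeta_prob_oo mule1.
rewrite [X in (_ + _ * X)%E]diracE memNset.
  by rewrite mule0 adde0.
by rewrite /= in_itv/= ltxx andbF.
Qed.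

End mixture.

Theorem theorem3p6 (R : realType) (p0 a b p : R)
  (hp0 : 0 < p0 < 1) (a0 : 0 < a) (b0 : 0 < b) (p01 : 0 < p < 1) :
  let G := mixture_prob p01 (rbeta_prob a0 b0) \d_(1 : R) in
  let m := gate_moment G in
  let r := fun k : nat => p0 / (p0 + (1 - p0) * m k) in
  let l := fun k : nat => ln (p0 / (1 - p0)) - ln (m k) in
  let r_oo := p0 / (p0 + (1 - p0) * (1 - p)) in
  [/\ decreasing_seq m,
      m @ \oo --> 1 - p,
      ereal_sup (range (fun k : nat => (l k - l 0%N)%:E)) = (- ln (1 - p))%:E,
      r @ \oo --> r_oo
    & r_oo < 1].
Proof.
move=> G m r l r_oo.
have /andP[p00 p01'] := hp0; have /andP[p_gt0 p_lt1] := p01.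
have G01 : G (~` `[0, 1]) = 0%E by exact: mixture_setC_cc.
have m_decr : decreasing_seq m.
  by apply: gate_moment_decreasing => //; rewrite [ltRHS]mixture_oo lte_fin.
have m_cvg : m @ \oo --> 1 - p.
  by have := gate_moment_cvg G01; rewrite [X in fine X]mixture_set1.
(* [decreasing_seq] is an equivalence of the two orders, hence strict; only one direction is needed
   here. *)
have m_ni : {homo m : i j / (i <= j)%N >-> j <= i}.
  by move=> i j; rewrite -m_decr.
(* A nonincreasing sequence stays above its limit. This keeps every [m k] positive, where [ln] is
   monotone. *)
have m_ge k : 1 - p <= m k.
  rewrite -(cvg_lim _ m_cvg)//; apply: nonincreasing_cvgn_ge => //.
  exact: cvgP m_cvg.
have q_gt0 : 0 < 1 - p by lra.
have m_gt0 k : 0 < m k by apply: lt_le_trans (m_ge k).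
have D_gt0 : 0 < p0 + (1 - p0) * (1 - p) by nra.
split => //.
- have lE k : l k - l 0%N = - ln (m k).
    by rewrite /l /m gate_moment0 ln1 subr0 addrAC subrr add0r.
  under [X in range X]eq_fun do rewrite lE.
  have lnm_cvg : (- ln (m k))%:E @[k --> \oo] --> (- ln (1 - p))%:E.
    apply: cvg_EFin; first exact: nearW.
    by apply: cvgN; apply: continuous_cvg => //; exact: continuous_ln.
  (* A nondecreasing sequence of extended reals converges to its supremum, so uniqueness of the
     limit identifies the two values. *)
  rewrite -(cvg_lim _ lnm_cvg)//; apply/esym/cvg_lim => //.
  apply: ereal_nondecreasing_cvgn => i j ij.
  by rewrite lee_fin lerN2 ler_ln ?posrE// m_ni.
- apply: cvgM; first exact: cvg_cst.
  apply: cvgV; first by rewrite gt_eqF.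
  by apply: cvgD; [exact: cvg_cst|apply: cvgM => //; exact: cvg_cst].
- by rewrite /r_oo ltr_pdivrMr// mul1r ltrDl mulr_gt0// subr_gt0.
Qed.
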